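(* Let $((\Phi_N)_{N\in\mathbb{N}},\tau)$ be an averaging scheme which satisfies an Erdős–Kac type theorem, i.e. there exists a constant $c>0$ such that for every $\gamma\in\mathbb{R}$, \[ \lim_{N\to\infty}\frac{\#\left\{k\in\Phi_N:\frac{\tau(k)-c\log\log N}{\sqrt{c\log\log N}}\le\gamma\right\}}{\#\Phi_N}=\frac{1}{\sqrt{2\pi}}\int_{-\infty}^{\gamma}e^{-t^2/2}\,dt. \] Then $((\Phi_N)_{N\in\mathbb{N}},\tau)$ satisfies the strong sweeping-out property: for every invertible, ergodic, non-atomic measure-preserving system $(X,\mathcal{X},\mu,T)$ and every $\varepsilon>0$ there is a set $E\in\mathcal{X}$ with $\mu(E)<\varepsilon$ such that for $\mu$-almost every $x\in X$, \[ \limsup_{N\to\infty}\frac{1}{\#\Phi_N}\sum_{k\in\Phi_N}\mathbf{1}_E(T^{\tau(k)}x)=1\quad\text{and}\quad\liminf_{N\to\infty}\frac{1}{\#\Phi_N}\sum_{k\in\Phi_N}\mathbf{1}_E(T^{\tau(k)}x)=0. \]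
   Context: An averaging scheme is a pair $((\Phi_N)_{N\in\mathbb{N}},\tau)$ where $(\Phi_N)_{N\in\mathbb{N}}$ is a sequence of nonempty finite sets and $\tau\colon\bigcup_{N\in\mathbb{N}}\Phi_N\to\mathbb{N}\cup\{0\}$ is a function. A measure-preserving system is a quadruple $(X,\mathcal{X},\mu,T)$ with $(X,\mathcal{X},\mu)$ a probability space and $T\colon X\to X$ measurable with $\mu(T^{-1}A)=\mu(A)$ for all $A\in\mathcal{X}$; by standing convention $X$ is a compact metric space, $\mathcal{X}$ its Borel $\sigma$-algebra and $\mu$ a Borel probability measure. It is invertible if $T$ is invertible with measurable inverse, and ergodic if $A=T^{-1}A$, $A\in\mathcal{X}$, implies $\mu(A)\in\{0,1\}$. Non-atomic means $\mu(\{x\})=0$ for all $x\in X$. *)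

(* Defs.v *)
From HB Require Import structures.
From mathcomp Require Import all_boot all_order all_algebra finmap.
From mathcomp Require Import all_classical all_reals all_analysis.
Set Implicit Arguments.
Unset Strict Implicit.
Unset Printing Implicit Defensive.
Import Order.TTheory GRing.Theory Num.Theory.
Import numFieldNormedType.Exports.

Local Open Scope classical_set_scope.
Local Open Scope ring_scope.

(** The natural numbers indexing [Phi] start at 1, so nothing is required of
    [Phi 0]; every use below is a limit as N tends to infinity. The function
    [tau] is total on the ambient type, but only its values on the sets [Phi N]
    with 0 < N are ever relevant. *)
Record averaging_scheme := AveragingScheme {
  idx : choiceType ;
  Phi : nat -> {fset idx} ;
  tau : idx -> nat ;
  Phi_neq0 : forall N, (0 < N)%N -> Phi N != fset0
}.

Definition normal_cdf (R : realType) (g : R) : R :=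
  (Num.sqrt (2 * pi))^-1 *
  \int[lebesgue_measure]_(t in `]-oo, g]) expR (- (t ^+ 2) / 2).

Definition erdos_kac (R : realType) (S : averaging_scheme) : Prop :=
  exists2 c : R, 0 < c & forall g : R,
    let loglog N : R := ln (ln N%:R) in
    (fun N : nat =>
       #|` [fset k in Phi S N |
             ((tau k)%:R - c * loglog N) / Num.sqrt (c * loglog N) <= g]%fset
        |%:R / #|` Phi S N|%:R) @ \oo --> normal_cdf g.

(** [measurableType] requires a chosen point; this is harmless for the
    nonempty spaces that carry a probability measure. *)
#[short(type="pointedMetricType")]
HB.structure Definition PointedMetric (K : numDomainType) :=
  {M of Pointed M & Metric K M}.

Notation borel X := (g_sigma_algebraType (@open X)).

Record mps (R : realType) := MPS {
  mps_space : pointedMetricType R ;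
  mps_compact : compact [set: mps_space] ;
  mps_mu : probability (borel mps_space) R ;
  mps_T : borel mps_space -> borel mps_space ;
  mps_measurable : measurable_fun setT mps_T ;
  mps_preserving : forall A : set (borel mps_space),
    measurable A -> mps_mu (mps_T @^-1` A) = mps_mu A
}.
Arguments mps_T {R} m.

Definition invertible (R : realType) (X : mps R) : Prop :=
  exists S : borel (mps_space X) -> borel (mps_space X),
    [/\ cancel (mps_T X) S, cancel S (mps_T X) & measurable_fun setT S].

Definition ergodic (R : realType) (X : mps R) : Prop :=
  forall A : set (borel (mps_space X)), measurable A ->
    A = mps_T X @^-1` A -> mps_mu X A = 0%E \/ mps_mu X A = 1%E.

Definition non_atomic (R : realType) (X : mps R) : Prop :=
  forall x : borel (mps_space X), mps_mu X [set x] = 0%E.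

Definition visit_avg (R : realType) (S : averaging_scheme) (X : mps R)
    (E : set (borel (mps_space X))) (x : borel (mps_space X)) (N : nat) : R :=
  (#|` Phi S N|%:R)^-1 *
  \sum_(k <- Phi S N) \1_E (iter (tau k) (mps_T X) x).

Definition strong_sweeping_out (R : realType) (S : averaging_scheme) : Prop :=
  forall X : mps R, invertible X -> ergodic X -> non_atomic X ->
  forall eps : R, 0 < eps ->
  exists E : set (borel (mps_space X)),
    [/\ measurable E, (mps_mu X E < eps%:E)%E &
     {ae mps_mu X, forall x,
        limn_esup (fun N => (visit_avg S E x N)%:E) = 1%E /\
        limn_einf (fun N => (visit_avg S E x N)%:E) = 0%E}].

(* Main.v *)
Require Import Defs.
From HB Require Import structures.
From mathcomp Require Import all_boot all_order all_algebra finmap.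
From mathcomp Require Import all_classical all_reals all_analysis.
From mathcomp Require Import lra zify.

(** The distribution of [tau] on [Phi N] is concentrated around
    [L = c log log N] at the scale [sqrt L], and as [N] varies [L] takes values
    close to every large real number. So for every large [n] there is an [N]
    whose average is, up to a small error, an average over the times
    [n, ..., n + h], where [h] may be chosen small compared to the size of the
    range of [n] under consideration ([erdos_kac_windows]). Averages of this
    kind, over windows that drift away faster than they grow, are the classical
    source of strong sweeping out.

    On the dynamical side, ergodicity and the absence of atoms give, for every
    [M], a set [B] of measure at most [2 / M] which almost every orbit visits
    in every [M] consecutive times ([sparse_recurrent_set], a weak form of
    Rokhlin's lemma). Its thickening [G], the union of its first [h + 1] images
    under the transformation, has measure at most [2 (h + 1) / M], and almost
    every orbit stays in [G] during a whole window [n, ..., n + h] that starts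
    at one of [M] prescribed consecutive times ([thin_sweeping_set]). Windows
    of length about [sqrt M] suffice for times of order [M], so the measure of
    [G] can be made as small as desired.

    Iterating with rapidly decreasing measures gives sets [G 0, G 1, ...]. A
    point is put in [E] when the last [G q] containing it has even index.
    Since the measures of the later sets are tiny compared to the inverse of
    the time needed to see a window in [G q], Borel-Cantelli shows that for almost every point and all large
    [q] the window spent in [G q] avoids all later sets. It therefore lies
    in [E] for even [q] and in the complement of [E] for odd [q]
    ([alternating_sweep]), which makes the averages come arbitrarily close to
    1 and to 0 infinitely often. *)

Set Implicit Arguments.
Unset Strict Implicit.
Unset Printing Implicit Defensive.
Import Order.TTheory GRing.Theory Num.Theory.
Import numFieldNormedType.Exports.
Local Open Scope classical_set_scope.
Local Open Scope ring_scope.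

(** * Sparse sets with bounded return times *)

Section dynamics.
Context d (X : measurableType d) (R : realType) (P : probability X R).
Variable f : X -> X.
Hypothesis mf : measurable_fun setT f.
Hypothesis fP : forall A, measurable A -> P (f @^-1` A) = P A.

Lemma preimage_iterS n (A : set X) :
  iter n.+1 f @^-1` A = f @^-1` (iter n f @^-1` A).
Proof. by apply/funext => x; rewrite /preimage /= -iterSr. Qed.

Lemma measurable_iter_preimage n A :
  measurable A -> measurable (iter n f @^-1` A).
Proof.
move=> mA; elim: n => [//|n IH]; rewrite preimage_iterS.
by rewrite -[X in measurable X]setTI; exact: mf.
Qed.

Lemma iter_preserving n A : measurable A -> P (iter n f @^-1` A) = P A.
Proof.
move=> mA; elim: n => [//|n <-]; rewrite preimage_iterS.
by rewrite fP//; exact: measurable_iter_preimage.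
Qed.

(** The set of points visiting [A] infinitely often is exactly invariant, which
    is what the ergodicity hypothesis asks for; its measure is the limit of the
    measures of the sets of points visiting [A] after time [n], each at least
    that of [A]. *)
Lemma infinitely_often_full A :
    (forall B, measurable B -> B = f @^-1` B -> P B = 0%E \/ P B = 1%E) ->
    measurable A -> (0 < P A)%E ->
  P (lim_sup_set (fun n => iter n f @^-1` A)) = 1%E.
Proof.
move=> ergf mA PA; set L := lim_sup_set _.
have mfA n : measurable (iter n f @^-1` A) by exact: measurable_iter_preimage.
have mL : measurable L.
  by apply: bigcap_measurable => // k _; exact: bigcup_measurable.
have PL : (P A <= P L)%E.
  have cvL : P (\bigcup_(k >= n) (iter k f @^-1` A)) @[n --> \oo] --> P L.
    apply: lim_sup_set_cvg => //; apply: (@le_lt_trans _ _ 1%E); last exact: ltry.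
    by apply: probability_le1; exact: bigcup_measurable.
  rewrite -(cvg_lim _ cvL)//; apply: lime_ge; first by apply/cvg_ex; exists (P L).
  apply: nearW => n; rewrite -(iter_preserving n mA).
  apply: le_measure; rewrite ?inE//; first exact: bigcup_measurable.
  by move=> x Ax; exists n => /=.
have [|PL0|//] := ergf _ mL; last by move: PL; rewrite PL0 leNgt PA.
apply/seteqP; split => x Lx n _.
  have [k /= nk Ak] := Lx n.+1 I.
  exists k.-1; first by case: k nk {Ak}.
  by case: k nk Ak => // k _; rewrite /= -iterSr.
have [k /= nk] := Lx n I; rewrite /preimage/= -iterSr => Ak.
by exists k.+1 => //=; rewrite ltnW.
Qed.

Definition first_hit (A : set X) (j : nat) : set X :=
  [set x | A (iter j f x) /\ forall i, (i < j)%N -> ~ A (iter i f x)].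

Lemma measurable_first_hit A j : measurable A -> measurable (first_hit A j).
Proof.
move=> mA.
have -> : first_hit A j = iter j f @^-1` A `&`
    \bigcap_(i in [set i | (i < j)%N]) ~` (iter i f @^-1` A).
  by apply/seteqP; split.
apply: measurableI; first exact: measurable_iter_preimage.
apply: bigcap_measurableType => i _.
by apply: measurableC; exact: measurable_iter_preimage.
Qed.

Lemma first_hit_uniq A i j x : first_hit A i x -> first_hit A j x -> i = j.
Proof.
move=> [Ai ni] [Aj nj]; apply/eqP; rewrite eqn_leq.
by apply/andP; split; rewrite leqNgt; apply/negP; [move=> /ni|move=> /nj].
Qed.

Lemma first_hit_shift A i j x :
  first_hit A (j + i) x -> first_hit A j (iter i f x).
Proof.
move=> [Aij nij]; split; rewrite -?iterD// => k kj.
by rewrite -iterD; apply: nij; rewrite ltn_add2r.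
Qed.

Lemma first_hit_exists A n x : A (iter n f x) -> exists j, first_hit A j x.
Proof.
move=> An; have ex : exists n, `[<A (iter n f x)>] by exists n; apply/asboolP.
case: (ex_minnP ex) => j /asboolP Aj jmin; exists j; split => // i ij /asboolP.
by move/jmin; rewrite leqNgt ij.
Qed.

(** [B] collects the points whose first hitting time of [A] is a multiple of
    [M]. Along an orbit this time decreases by one at each step until it
    vanishes, so a multiple of [M] occurs among any [M] consecutive times.
    The bound on the measure comes from the part of [B] where the time is
    positive: it is carried by [f ^ i], for [i < M], into the set [C i] of
    points whose hitting time is positive and congruent to [- i] modulo [M],
    and these [M] sets are disjoint. *)
Lemma sparse_recurrent_set (A : set X) (M : nat) : (0 < M)%N ->
    measurable A -> (P A <= (M%:R^-1)%:E)%E ->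
  exists B, [/\ measurable B, (P B <= (2 / M%:R)%:E)%E &
    forall x, lim_sup_set (fun n => iter n f @^-1` A) x ->
      forall n0, exists2 n, (n0 <= n < n0 + M)%N & B (iter n f x)].
Proof.
move=> M0 mA PA.
have mhit j := measurable_first_hit j mA.
pose B' := \bigcup_k first_hit A (k.+1 * M).
have mB' : measurable B' by exact: bigcup_measurable.
pose C i := \bigcup_k first_hit A (k.+1 * M - i).
have mC i : measurable (C i) by exact: bigcup_measurable.
have trC : trivIset `I_M C.
  move=> i j /= iM jM [x [[k _ xk] [l _ xl]]].
  have e := first_hit_uniq xk xl.
  have kM : (i <= k.+1 * M)%N by rewrite (leq_trans (ltnW iM))// leq_pmull.
  have lM : (j <= l.+1 * M)%N by rewrite (leq_trans (ltnW jM))// leq_pmull.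
  have /(congr1 (modn^~ M)) : (k.+1 * M + j = l.+1 * M + i)%N by lia.
  by rewrite !modnMDl !modn_small.
have PC i : (i < M)%N -> (P B' <= P (C i))%E.
  move=> iM; rewrite -(iter_preserving i (mC i)); apply: le_measure.
  - by rewrite inE.
  - by rewrite inE; exact: measurable_iter_preimage.
  - move=> x [k _ xk]; exists k => //; apply: first_hit_shift.
    by rewrite subnK// (leq_trans (ltnW iM))// leq_pmull.
have PB' : (P B' <= (M%:R^-1)%:E)%E.
  have mUC : measurable (\bigcup_(i in `I_M) C i) by exact: bigcup_measurable.
  have := probability_le1 P mUC.
  rewrite (measure_fin_bigcup P)// -fsbig_ord => le1.
  have : (\sum_(i < M) P B' <= 1)%E.
    by apply: le_trans le1; apply: lee_sum => i _; exact: PC.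
  have /fineK <- : P B' \is a fin_num by exact: fin_num_measure.
  rewrite sumEFin sumr_const card_ord !lee_fin => h.
  by rewrite -div1r ler_pdivlMr ?ltr0n// mulr_natr.
exists (A `|` B'); split; first exact: measurableU.
- apply: (le_trans (measureU2 P mA mB')).
  apply: (le_trans (leeD PA PB')).
  by rewrite -EFinD lee_fin mulr_natl.
- move=> x Lx n0; have [k /= n0k Ak] := Lx n0 I.
  have [r xr] : exists r, first_hit A r (iter n0 f x).
    by apply: (@first_hit_exists _ (k - n0)); rewrite -iterD subnK.
  exists (r %% M + n0)%N; first by rewrite leq_addl/= addnC ltn_add2l ltn_pmod.
  rewrite iterD; have := xr; rewrite {1}(divn_eq r M) => /first_hit_shift.
  case: (r %/ M)%N => [|q] xq; last by right; exists q.
  by left; case: xq.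
Qed.

End dynamics.

(** * Sets swept by long windows *)

Section sweeping.
Context d (X : measurableType d) (R : realType) (P : probability X R).
Variables f g : X -> X.
Hypothesis mf : measurable_fun setT f.
Hypothesis fP : forall A, measurable A -> P (f @^-1` A) = P A.
Hypothesis mg : measurable_fun setT g.
Hypothesis fgK : cancel f g.
Hypothesis ergf :
  forall B, measurable B -> B = f @^-1` B -> P B = 0%E \/ P B = 1%E.
Hypothesis small_sets : forall e : R, 0 < e ->
  exists A, [/\ measurable A, (0 < P A)%E & (P A <= e%:E)%E].

Lemma inverse_preserving A : measurable A -> P (g @^-1` A) = P A.
Proof.
move=> mA; rewrite -fP; last by rewrite -[X in measurable X]setTI; exact: mg.
by congr (P _); apply/funext => x; rewrite /preimage/= fgK.
Qed.

(** If the orbit of [x] is in [B] at time [n], then at a time [m >= n] it is in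
    the preimage of [B] under the [(m - n)]-th iterate of the inverse [g]; [G] is
    the union of these preimages over [m - n <= h]. *)
Lemma thin_sweeping_set (M h : nat) : (0 < M)%N ->
  exists G, [/\ measurable G, (P G <= (h.+1%:R * (2 / M%:R))%:E)%E &
    {ae P, forall x, forall n0, exists2 n, (n0 <= n < n0 + M)%N &
      forall m, (n <= m <= n + h)%N -> G (iter m f x)}].
Proof.
move=> M0.
have [|A [mA PA0 PAM]] := @small_sets M%:R^-1; first by rewrite invr_gt0 ltr0n.
have [B [mB PB hitB]] := sparse_recurrent_set mf fP M0 mA PAM.
have mgB i : measurable (iter i g @^-1` B) by exact: measurable_iter_preimage.
have mG : measurable (\big[setU/set0]_(i < h.+1) (iter i g @^-1` B)).
  exact: bigsetU_measurable.
exists (\big[setU/set0]_(i < h.+1) (iter i g @^-1` B)); split => //.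
- apply: (le_trans (Boole_inequality P (A := fun i => iter i g @^-1` B) _)) => //.
  have -> : (\sum_(i < h.+1) P (iter i g @^-1` B) = \sum_(i < h.+1) P B)%E.
    apply: eq_bigr => i _; apply: iter_preserving => //.
    exact: inverse_preserving.
  have /fineK e : P B \is a fin_num by exact: fin_num_measure.
  rewrite -e; rewrite -e lee_fin in PB.
  by rewrite sumEFin sumr_const card_ord lee_fin mulr_natl lerMn2r PB orbT.
- have mfA n : measurable (iter n f @^-1` A).
    exact: measurable_iter_preimage.
  set L := lim_sup_set (fun n => iter n f @^-1` A) in hitB.
  have mL : measurable L.
    by apply: bigcap_measurable => // k _; exact: bigcup_measurable.
  exists (~` L); split; first exact: measurableC.
    by rewrite probability_setC// (infinitely_often_full mf fP)// subee.
  apply: subsetC => x Lx n0.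
  have [n nM Bn] := hitB x Lx n0; exists n => // m /andP[nm mn].
  rewrite -(bigcup_mkord _ (fun i => iter i g @^-1` B)).
  exists (m - n)%N; first by rewrite /= ltnS leq_subLR.
  rewrite /preimage/= -{2}(subnK nm) iterD.
  by elim: (m - n)%N => [//|k IH]; rewrite iterSr /= fgK.
Qed.

Lemma halving_sum (F : (set X)^nat) (e : R) : 0 <= e ->
    (forall k, (P (F k) <= (e / (2 ^ k.+1)%:R)%:E)%E) ->
  (\sum_(k <oo) P (F k) <= e%:E)%E.
Proof.
move=> e0 PF; apply: le_trans (epsilon_trick0 xpredT e0).
by apply: lee_nneseries => // k _; exact: PF.
Qed.

Lemma halving_union (F : (set X)^nat) (e : R) : 0 <= e ->
    (forall k, measurable (F k)) ->
    (forall k, (P (F k) <= (e / (2 ^ k.+1)%:R)%:E)%E) ->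
  (P (\bigcup_k F k) <= e%:E)%E.
Proof.
move=> e0 mF PF; apply: le_trans (halving_sum e0 PF).
by apply: measure_sigma_subadditive => //; exact: bigcup_measurable.
Qed.

(** [C q n h] reads: at precision [q], the times [n, ..., n + h] carry almost
    all the mass of some average. The hypothesis says that, at each precision,
    windows of some fixed length are available at all the times of a range that
    is long compared to this length. *)
Variable C : nat -> nat -> nat -> Prop.
Hypothesis C_windows : forall q (eta : R), 0 < eta -> exists n0 M h,
  [/\ (0 < M)%N, h.+1%:R * (2 / M%:R) <= eta &
    forall n, (n0 <= n < n0 + M)%N -> C q n h].

(** [H q] bounds the times at which the sets of index less than [q] are swept.
    Since it is known before [G q] is chosen, the measure of [G q] can be made
    small compared to [1 / H q]. *)
Lemma thin_sweeping_seq (eps : R) : 0 < eps ->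
  exists (G : (set X)^nat) (H : nat^nat),
  [/\ forall q, measurable (G q), {homo H : p q / (p <= q)%N},
    forall q, (P (G q) <= (eps / ((2 ^ q.+1)%:R * (H q).+1%:R))%:E)%E &
    forall q, {ae P, forall x, exists n h, [/\ (n + h <= H q.+1)%N, C q n h &
      forall m, (n <= m <= n + h)%N -> G q (iter m f x)]}].
Proof.
move=> eps0.
have step (qH : nat * nat) : exists GH : set X * nat,
    [/\ measurable GH.1, (qH.2 <= GH.2)%N,
    (P GH.1 <= (eps / ((2 ^ qH.1.+1)%:R * qH.2.+1%:R))%:E)%E &
    {ae P, forall x, exists n h, [/\ (n + h <= GH.2)%N, C qH.1 n h &
      forall m, (n <= m <= n + h)%N -> GH.1 (iter m f x)]}].
  have [|n0 [M [h [M0 hM Cn]]]] :=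
    @C_windows qH.1 (eps / ((2 ^ qH.1.+1)%:R * qH.2.+1%:R)).
    by rewrite divr_gt0// mulr_gt0// ltr0n expn_gt0.
  have [G [mG PG aeG]] := thin_sweeping_set h M0.
  exists (G, maxn qH.2 (n0 + M + h)); split => //=; first exact: leq_maxl.
    by apply: le_trans PG _; rewrite lee_fin.
  apply: filterS aeG => x /(_ n0)[n nM Gn]; exists n, h; split => //; last exact: Cn.
  by rewrite leq_max leq_add2r; apply/orP; right; case/andP: nM => _ /ltnW.
have [F FP] := choice step.
pose H := fix H q := if q is p.+1 then (F (p, H p)).2 else 0%N.
exists (fun q => (F (q, H q)).1), H; split.
- by move=> q; have [] := FP (q, H q).
- apply: homo_leq => // [? ? ?|q]; first exact: leq_trans.
  by have [] := FP (q, H q).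
- by move=> q; have [] := FP (q, H q).
- by move=> q; have [] := FP (q, H q).
Qed.

(** [E] is the set of points for which the last [G q] containing them has even
    index [q]. The points whose orbit meets some [G r], [r > q], up to the time
    [H q.+1] by which [G q] is swept form a set [Bad q] of measure
    at most [eps / 2 ^ q.+1], so almost every point is in only finitely many of
    them. *)
Lemma alternating_sweep (eps : R) : 0 < eps ->
  exists E, [/\ measurable E, (P E <= eps%:E)%E &
    {ae P, forall x, forall q0,
      (exists q n h, [/\ (q0 <= q)%N, C q n h &
         forall m, (n <= m <= n + h)%N -> E (iter m f x)]) /\
      (exists q n h, [/\ (q0 <= q)%N, C q n h &
         forall m, (n <= m <= n + h)%N -> ~ E (iter m f x)])}].
Proof.
move=> eps0; have [G [H [mG ndH PG aeG]]] := thin_sweeping_seq eps0.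
pose U q := \bigcup_k G (q.+1 + k)%N.
have mU q : measurable (U q) by exact: bigcup_measurable.
have PU q : (P (U q) <= (eps / ((2 ^ q.+1)%:R * (H q.+1).+1%:R))%:E)%E.
  apply: halving_union => //; first by rewrite divr_ge0 ?mulr_ge0 ?ltW.
  move=> k; apply: (le_trans (PG _)); rewrite lee_fin -mulrA -invfM.
  rewrite ler_wpM2l ?(ltW eps0)// lef_pV2 ?posrE ?mulr_gt0 ?ltr0n ?expn_gt0//.
  rewrite -!natrM ler_nat mulnAC -expnD addnS.
  by rewrite leq_mul2l ltnS ndH ?orbT// leq_addr.
pose Bad q := \big[setU/set0]_(i < (H q.+1).+1) (iter i f @^-1` U q).
have mfU q i : measurable (iter i f @^-1` U q) by exact: measurable_iter_preimage.
have mBad q : measurable (Bad q) by exact: bigsetU_measurable.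
have PBad q : (P (Bad q) <= (eps / (2 ^ q.+1)%:R)%:E)%E.
  apply: (le_trans (Boole_inequality P (A := fun i => iter i f @^-1` U q) _)) => //.
  have -> : (\sum_(i < (H q.+1).+1) P (iter i f @^-1` U q) =
      \sum_(i < (H q.+1).+1) P (U q))%E.
    by apply: eq_bigr => i _; exact: iter_preserving.
  have /fineK e : P (U q) \is a fin_num by exact: fin_num_measure.
  have := PU q; rewrite -e sumEFin sumr_const card_ord !lee_fin invfM mulrA.
  by rewrite ler_pdivlMr ?ltr0n// mulr_natr.
have LBad : P (lim_sup_set Bad) = 0%E.
  apply: lim_sup_set_cvg0 => //.
  by apply: (le_lt_trans (halving_sum (ltW eps0) PBad)); exact: ltry.
pose E := \bigcup_(q in [set q | ~~ odd q]) (G q `\` U q).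
have mE : measurable E by apply: bigcup_measurable => q _; exact: measurableD.
exists E; split => //.
- apply: (@le_trans _ _ (P (\bigcup_q G q))).
    apply: le_measure; rewrite ?inE//; first exact: bigcup_measurable.
    by move=> x [q _ [Gx _]]; exists q.
  apply: halving_union => //; first exact: ltW.
  move=> q; apply: (le_trans (PG q)); rewrite lee_fin.
  rewrite ler_wpM2l ?(ltW eps0)// lef_pV2 ?posrE ?mulr_gt0 ?ltr0n ?expn_gt0//.
  by rewrite ler_peMr// ler1n.
- have aeBad : {ae P, forall x, ~ lim_sup_set Bad x}.
    exists (lim_sup_set Bad); split => //; last by move=> x /contrapT.
    by apply: bigcap_measurable => // k _; exact: bigcup_measurable.
  have /ae_foralln aeG' := aeG.
  apply: filterS2 aeBad aeG' => x nbad Gx q0.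
  have [q1 good] : exists q1, forall q, (q1 <= q)%N -> ~ Bad q x.
    move: nbad; rewrite /lim_sup_set => /existsNP[q1 /not_implyP[_ nb]].
    by exists q1 => q q1q Bx; apply: nb; exists q.
  have clean q n h m : (q1 <= q)%N -> (n + h <= H q.+1)%N ->
      (n <= m <= n + h)%N -> ~ U q (iter m f x).
    move=> q1q nhH /andP[_ mnh] Um; apply: (good q q1q).
    rewrite /Bad -(bigcup_mkord _ (fun i => iter i f @^-1` U q)); exists m => //=.
    by rewrite ltnS (leq_trans mnh).
  split.
  + pose q := ((q0 + q1).*2)%N.
    have [n [h [nhH Cq Gq]]] := Gx q.
    exists q, n, h; split => //; first by rewrite /q; lia.
    move=> m nm; exists q; first by rewrite /= odd_double.
    by split; [exact: Gq|apply: clean nhH nm; rewrite /q; lia].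
  + pose q := ((q0 + q1).*2.+1)%N.
    have [n [h [nhH Cq Gq]]] := Gx q.
    exists q, n, h; split => //; first by rewrite /q; lia.
    move=> m nm [p /= podd [Gp nUp]].
    have nUq : ~ U q (iter m f x) by apply: clean nhH nm; rewrite /q; lia.
    (* [f ^ m x] is in [G q] and in no later set, whereas [p] would have to be
       the even index of the last set containing it. *)
    have [pq|qp|pq] := ltngtP p q.
    * by apply: nUp; exists (q - p.+1)%N => //; rewrite subnKC//; exact: Gq.
    * by apply: nUq; exists (p - q.+1)%N => //; rewrite subnKC.
    * by move: podd; rewrite pq /q /= odd_double.
Qed.

End sweeping.

(** * Small sets of positive measure *)

(** Every point has an open neighbourhood of measure at most [e], because the
    balls around it shrink to a null set. By compactness finitely many of these
    neighbourhoods cover the space, so one of them is not null. *)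
Lemma non_atomic_small_sets (R : realType) (X : mps R) : non_atomic X ->
  forall e : R, 0 < e -> exists A, [/\ measurable A, (0 < mps_mu X A)%E &
    (mps_mu X A <= e%:E)%E].
Proof.
move=> na e e0; set mu := mps_mu X.
pose V := mps_space X.
have mopen (A : set V) : open A -> measurable (A : set (borel V)).
  by move=> oA; exact: sub_sigma_algebra.
have nbhd (x : V) : exists U : set V, [/\ open U, U x & (mu U <= e%:E)%E].
  pose F n : set V := (ball x n.+1%:R^-1)°.
  have oF n : open (F n) by exact: open_interior.
  have Fx n : F n x by apply: nbhsx_ballx; rewrite invr_gt0 ltr0n.
  have capF : \bigcap_n F n = [set x].
    apply/seteqP; split => [y Fy|y -> //].
    apply/esym/mdist_positivity/eqP; rewrite eq_le mdist_ge0 andbT.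
    apply/ler_addgt0Pl => d d0; rewrite addr0.
    have := interior_subset (Fy (Num.truncn d^-1) I); rewrite ballEmdist /= => /ltW xy.
    apply: (le_trans xy); rewrite -[leRHS]invrK lef_pV2 ?posrE ?invr_gt0 ?ltr0n//.
    by rewrite ltW// truncnS_gt.
  have : (mu \o F) n @[n --> \oo] --> mu (\bigcap_n F n).
    apply: nonincreasing_cvg_mu.
    - by apply: (le_lt_trans (probability_le1 _ _)); [exact: mopen|exact: ltry].
    - by move=> n; exact: mopen.
    - by apply: bigcap_measurableType => n _; exact: mopen.
    - move=> m n mn; apply/subsetPset; apply: interiorS; apply: le_ball.
      by rewrite lef_pV2 ?posrE ?ltr0n// ler_nat ltnS.
  rewrite capF na => mu0.
  have [n _ /(_ n (leqnn n)) /ltW Fn] : \forall n \near \oo, (mu (F n) < e%:E)%E.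
    by apply: (mu0 [set u | (u < e%:E)%E]); apply: open_ereal_lt'; rewrite lte_fin.
  by exists (F n).
have [U UP] := choice nbhd.
have := @mps_compact _ X; rewrite compact_cover.
move=> /(_ V setT U)[|x _|D _ covD].
- by move=> x _; have [] := UP x.
- by exists x => //; have [] := UP x.
apply: contrapT => nex.
have mU0 x : mu.-negligible (U x).
  have [oU _ Ue] := UP x; apply/negligibleP; first exact: mopen.
  apply/eqP; rewrite eq_le measure_ge0 andbT leNgt; apply/negP => U0.
  by apply: nex; exists (U x); split => //; exact: mopen.
have : mu.-negligible (\big[setU/set0]_(x <- D) U x).
  apply: (big_ind (fun A => mu.-negligible A)) => //.
  - exact: negligible_set0.
  - by move=> A B; exact: negligibleU.
rewrite -bigcup_fset => negD.
have : mu.-negligible [set: borel V].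
  by apply: negligibleS negD; exact: covD.
move/(measure_negligible measurableT) => mu0.
by have := probability_setT mu; rewrite mu0 => /esym/eqP; rewrite onee_eq0.
Qed.

(** * Concentration of the averaging scheme *)

Lemma normal_cdfE (R : realType) (r : R) :
  (normal_cdf r)%:E = normal_prob 0 1 `]-oo, r].
Proof.
have -> : normal_prob 0 1 `]-oo, r] =
    (fine (normal_prob 0 1 `]-oo, r]%classic))%:E :> \bar R.
  by rewrite fineK// fin_num_measure.
congr EFin; rewrite /normal_cdf /normal_prob.
have -> : fine (\int[lebesgue_measure]_(x in `]-oo, r]) (normal_pdf 0 1 x)%:E)
   = \int[lebesgue_measure]_(x in `]-oo, r])
       ((Num.sqrt (2 * pi))^-1 * expR (- (x ^+ 2) / 2)) :> R.
  congr fine; apply: eq_integral => x _; congr EFin.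
  rewrite normal_pdfE ?oner_eq0// /normal_peak /normal_fun subr0 expr1n mul1r.
  by rewrite mulr_natl.
rewrite RintegralZl//.
have p0 : normal_peak (1 : R) != 0 by rewrite gt_eqF// normal_peak_gt0// oner_eq0.
have : lebesgue_measure.-integrable `]-oo, r]
    (fun x : R => ((normal_peak (1 : R))^-1%:E * (normal_pdf 0 1 x)%:E)%E).
  apply: integrableZl => //.
  by apply: (integrableS _ _ (subsetT _)) => //; exact: integrable_normal_pdf.
apply: eq_integrable => // x _.
rewrite -EFinM normal_pdfE ?oner_eq0// mulKf//.
by rewrite /= /normal_fun subr0 expr1n.
Qed.

Lemma normal_cdf_window (R : realType) (del : R) : 0 < del ->
  exists2 K : R, 0 < K & 1 - del < normal_cdf K - normal_cdf (- K).
Proof.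
move=> del0.
have up : normal_prob 0 1 `]-oo, n%:R : R] @[n --> \oo] --> (1 : \bar R)%E.
  rewrite -(probability_setT (normal_prob (0 : R) 1)).
  have <- : \bigcup_n `]-oo, n%:R : R]%classic = setT.
    rewrite -subTset => t _; exists (Num.truncn t).+1 => //=.
    by rewrite in_itv/= ltW// truncnS_gt.
  apply: nondecreasing_cvg_mu => //; first exact: bigcup_measurable.
  by move=> m n mn; apply/subsetPset; apply: subset_itvl; rewrite bnd_simp ler_nat.
have down : normal_prob 0 1 `]-oo, - n%:R : R] @[n --> \oo] --> (0 : \bar R)%E.
  rewrite -(measure0 (normal_prob (0 : R) 1)).
  have <- : \bigcap_n `]-oo, - n%:R : R]%classic = set0.
    rewrite -subset0 => t /(_ (Num.truncn (- t)).+1 I).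
    by rewrite /= in_itv/= leNgt => /negP; apply; rewrite ltrNl truncnS_gt.
  apply: nonincreasing_cvg_mu => //.
  - by rewrite (le_lt_trans (probability_le1 _ _)) ?ltry.
  - exact: bigcap_measurable.
  - move=> m n mn; apply/subsetPset; apply: subset_itvl.
    by rewrite bnd_simp lerN2 ler_nat.
have [n [n0 un dn]] : exists n : nat, [/\ (0 < n)%N,
    ((1 - del / 2)%:E < normal_prob 0 1 `]-oo, (n%:R : R)%R])%E &
    (normal_prob 0 1 `]-oo, (- n%:R : R)%R] < (del / 2)%:E)%E].
  near \oo => n; exists n; split.
  - by near: n; exact: nbhs_infty_gt.
  - by near: n; apply: (up [set u | ((1 - del / 2)%:E < u)%E]); apply: open_ereal_gt'; rewrite lte_fin; lra.
  - by near: n; apply: (down [set u | (u < (del / 2)%:E)%E]); apply: open_ereal_lt'; rewrite lte_fin; lra.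
exists n%:R; first by rewrite ltr0n.
by move: un dn; rewrite -!normal_cdfE !lte_fin; lra.
Unshelve. all: by end_near. Qed.

(** Rounding [exp (exp y)] up to an integer changes its iterated logarithm by
    less than 1, because it at most doubles the number. *)
Lemma loglog_dense (R : realType) (y : R) : 0 <= y ->
  exists N : nat, [/\ y <= N%:R, y <= ln (ln N%:R) & ln (ln N%:R) <= y + 1].
Proof.
move=> y0; pose u := expR (expR y); exists (Num.truncn u).+1.
have u0 : 0 <= u by exact: expR_ge0.
have /andP[uN Nu] := truncn_itv u0.
set N : R := (Num.truncn u).+1%:R in Nu *.
have e1y : 1 <= expR y by rewrite -expR0 ler_expR.
have leu : expR y <= ln N by rewrite -[expR y]expRK ler_ln ?posrE ?expR_gt0 ?ltW// ltr0n.
have yN : y <= N.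
  apply: le_trans (ltW Nu); apply: (@le_trans _ _ (expR y)).
    by apply: le_trans (expR_ge1Dx _); rewrite lerDr.
  by apply: le_trans (expR_ge1Dx _); rewrite lerDr.
split => //.
  by rewrite -[y]expRK ler_ln ?posrE ?expR_gt0// (lt_le_trans _ leu)// expR_gt0.
have N2u : N <= expR (expR (y + 1)).
  have Nu1 : N <= u + 1 by rewrite /N -natr1 lerD2r.
  apply: (le_trans Nu1).
  have e2 : 2 <= expR 1 :> R by apply: le_trans (expR_ge1Dx _); rewrite -natr1.
  have u1 : 1 <= u by rewrite -expR0 ler_expR expR_ge0.
  apply: (@le_trans _ _ (u * expR 1)); first nra.
  by rewrite -expRD ler_expR expRD; nra.
have lnN0 : 0 < ln N by rewrite (lt_le_trans _ leu)// expR_gt0.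
rewrite -[leRHS]expRK ler_ln ?posrE ?expR_gt0//.
by rewrite -[leRHS]expRK ler_ln ?posrE ?expR_gt0// /N ltr0n.
Qed.

(** The limit law at [K] minus the limit law at [- K], where [K] is taken so
    large that the Gaussian mass of the interval between them exceeds
    [1 - del]. *)
Lemma erdos_kac_concentration (R : realType) (S : averaging_scheme) (del : R) :
    erdos_kac R S -> 0 < del ->
  exists c K : R, [/\ 0 < c, 0 < K & \forall N \near \oo,
    (1 - del) * #|` Phi S N|%:R <=
    #|` [fset k in Phi S N | - K < ((tau k)%:R - c * ln (ln N%:R)) /
                                   Num.sqrt (c * ln (ln N%:R)) <= K]%fset|%:R :> R].
Proof.
move=> [c c0 hEK] del0; have [K K0 hK] := normal_cdf_window del0.
exists c, K; split => //.
have hN := cvgr_gt _ (cvgB (hEK K) (hEK (- K))) _ hK.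
apply: filterS2 (nbhs_infty_gt 0) (hN _ _) => N N0.
have Phi0 : 0 < #|` Phi S N|%:R :> R by rewrite ltr0n cardfs_gt0 Phi_neq0.
rewrite /= -mulrBl ltr_pdivlMr// => /ltW /le_trans; apply.
rewrite lerBlDr -natrD ler_nat.
apply: leq_trans (leq_card_fsetU _ _) ; apply: fsubset_leq_card.
apply/fsubsetP => k; rewrite !inE /= => /andP[-> ->] /=.
by rewrite andbT ltNge orNb.
Qed.

(** The window of [N] is centred at [c log log N] with half-width
    [K sqrt (c log log N)]. For [n] ranging over an interval of length [D * w],
    it has length of order [sqrt w] and hence fits into [n, ..., n + 2 w] once
    [w] is large, provided that [N] is chosen with [c log log N] close to the
    midpoint [n + w]. The factor [D] is chosen, independently of [w], to make
    the ratio [(2 w + 1) / (D w)] small. *)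
Lemma erdos_kac_windows (R : realType) (S : averaging_scheme) (del eta : R)
    (N1 : nat) : erdos_kac R S -> 0 < del -> 0 < eta ->
  exists n0 M h, [/\ (0 < M)%N, h.+1%:R * (2 / M%:R) <= eta &
    forall n, (n0 <= n < n0 + M)%N -> exists2 N, (N1 <= N)%N &
      (1 - del) * #|` Phi S N|%:R <=
      #|` [fset k in Phi S N | (n <= tau k <= n + h)%N]%fset|%:R :> R].
Proof.
move=> hEK del0 eta0.
have [c [K [c0 K0 [N2 _ hN]]]] := erdos_kac_concentration hEK del0.
pose n0 := (Num.truncn (c * (maxn N1 N2)%:R)).+1.
have n0c : c * (maxn N1 N2)%:R <= n0%:R by rewrite ltW// truncnS_gt.
pose D := (Num.truncn (6 / eta)).+1.
have De : 6 / eta <= D%:R by rewrite ltW// truncnS_gt.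
(* [w >= 2 c] absorbs the error in the position of the centre, and the other
   term ensures [K * sqrt L <= w / 2] for all the centres [L] that occur. *)
pose B := 4 * K ^+ 2 * (n0%:R + D%:R + 1 + c) + 2 * c.
pose w := (Num.truncn B).+1.
have Bw : B <= w%:R by rewrite ltW// truncnS_gt.
have K2 : 0 <= K ^+ 2 by exact: sqr_ge0.
have w1 : 1 <= w%:R :> R by rewrite ler1n.
have D1 : 1 <= D%:R :> R by rewrite ler1n.
have n01 : 1 <= n0%:R :> R by rewrite ler1n.
have B0 : 0 <= K ^+ 2 * (n0%:R + D%:R + 1 + c) by apply: mulr_ge0 => //; lra.
have w2c : 2 * c <= w%:R by apply: le_trans Bw; rewrite /B; lra.
have wK : 4 * (K ^+ 2 * (n0%:R + D%:R + 1 + c)) <= w%:R.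
  by apply: le_trans Bw; rewrite /B; lra.
exists n0, (D * w)%N, (2 * w)%N; split; first by rewrite muln_gt0.
  rewrite -natr1 !natrM mulrA ler_pdivrMr; last by apply: mulr_gt0; lra.
  rewrite ler_pdivrMr// in De.
  apply: (@le_trans _ _ (6 * w%:R)); first lra.
  by rewrite mulrA ler_wpM2r//; lra.
move=> n /andP[n0n nM].
have n0n' : n0%:R <= n%:R :> R by rewrite ler_nat.
have nM' : n%:R <= n0%:R + D%:R * w%:R :> R.
  by rewrite -natrM -natrD ler_nat ltnW.
have [|N [yN loN hiN]] := @loglog_dense R ((n%:R + w%:R) / c).
  by apply: divr_ge0; lra.
rewrite ler_pdivrMr// in yN.
have maxN : (maxn N1 N2 <= N)%N.
  rewrite -(ler_nat R) -(ler_pM2l c0).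
  by apply: (le_trans n0c); rewrite (mulrC c); lra.
rewrite geq_max in maxN; case/andP: maxN => N1N N2N.
exists N => //; apply: (le_trans (hN N N2N)); rewrite ler_nat.
apply: fsubset_leq_card; apply/fsubsetP => k; rewrite !inE /=.
move=> /andP[-> /=].
set L := c * ln (ln N%:R).
have Llo : n%:R + w%:R <= L by rewrite /L mulrC -ler_pdivrMr.
have Lhi : L <= n%:R + w%:R + c.
  rewrite /L mulrC -ler_pdivlMr// mulrDl divff ?gt_eqF//.
have L0 : 0 < L by apply: lt_le_trans Llo; lra.
have sL0 : 0 < Num.sqrt L by rewrite sqrtr_gt0.
have sLw : K * Num.sqrt L <= w%:R / 2.
  rewrite -(@ler_pXn2r _ 2)// ?nnegrE; [|by rewrite mulr_ge0 ?ltW|by rewrite divr_ge0; lra].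
  rewrite exprMn sqr_sqrtr ?(ltW L0)//.
  apply: (@le_trans _ _ (K ^+ 2 * ((n0%:R + D%:R + 1 + c) * w%:R))).
    apply: ler_wpM2l => //; apply: (le_trans Lhi).
    have n0w : n0%:R <= n0%:R * w%:R :> R by rewrite ler_peMr.
    have cw : c <= c * w%:R by rewrite ler_peMr// ltW.
    lra.
  rewrite mulrA; nra.
rewrite ltr_pdivlMr// ler_pdivrMr// => /andP[lo hi].
rewrite -!(ler_nat R) natrD natrM; apply/andP; split; lra.
Qed.

(** * Upper and lower limits of visit averages *)

Lemma limn_esup_eq1 (R : realType) (u : R^nat) : (forall n, u n <= 1) ->
    (forall q : nat, exists2 N, (q <= N)%N & 1 - q.+1%:R^-1 <= u N) ->
  limn_esup (EFin \o u) = 1%E.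
Proof.
move=> u1 hu; rewrite limn_esup_lim; apply/eqP; rewrite eq_le; apply/andP; split.
  apply: lime_le; first exact: is_cvg_esups.
  apply: nearW => n; apply: ge_ereal_sup => _ [k _ <-].
  by rewrite lee_fin.
apply: lime_ge; first exact: is_cvg_esups.
apply: nearW => n; apply/lee_addgt0Pr => e e0.
have [N qN uN] := hu (maxn n (Num.truncn e^-1)).
apply: (@le_trans _ _ ((u N)%:E + e%:E)%E).
  rewrite -EFinD lee_fin -lerBlDr; apply: le_trans uN.
  rewrite lerB// -[leRHS]invrK lef_pV2 ?posrE ?invr_gt0 ?ltr0n//.
  apply/ltW/(lt_le_trans (truncnS_gt _)).
  by rewrite ler_nat ltnS leq_maxr.
rewrite leeD2r//; apply: ereal_sup_ubound; exists N => //=.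
by rewrite (leq_trans _ qN)// leq_maxl.
Qed.

Lemma limn_einf_eq0 (R : realType) (u : R^nat) : (forall n, 0 <= u n) ->
    (forall q : nat, exists2 N, (q <= N)%N & u N <= q.+1%:R^-1) ->
  limn_einf (EFin \o u) = 0%E.
Proof.
move=> u0 hu.
have -> : EFin \o u = (fun n => 1%E + (u n - 1)%:E)%E.
  by apply/funext => n; rewrite /= -EFinD addrC subrK.
rewrite limn_einf_shift// /limn_einf.
have -> : (\- (fun n => (u n - 1)%:E))%E = EFin \o (fun n => 1 - u n).
  by apply/funext => n; rewrite /= opprB.
suff -> : limn_esup (EFin \o (fun n => 1 - u n)) = 1%E by rewrite subee.
apply: limn_esup_eq1 => [n|q]; first by rewrite gerBl.
by have [N qN uN] := hu q; exists N => //; rewrite lerB.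
Qed.

Section visits.
Context (R : realType) (S : averaging_scheme) (X : mps R).
Variables (E : set (borel (mps_space X))) (x : borel (mps_space X)).

Lemma visit_avg_ge0 N : 0 <= visit_avg S E x N.
Proof.
rewrite /visit_avg mulr_ge0 ?invr_ge0//.
by apply: sumr_ge0 => k _; rewrite indicE.
Qed.

Lemma visit_avg_le1 N : visit_avg S E x N <= 1.
Proof.
have [Phi0|Phi0] := eqVneq #|` Phi S N| 0%N.
  by rewrite /visit_avg Phi0 invr0 mul0r.
rewrite /visit_avg mulrC ler_pdivrMr ?mul1r; last by rewrite ltr0n lt0n.
rewrite -sum1_size natr_sum; apply: ler_sum => k _.
by rewrite indicE lern1 leq_b1.
Qed.

Lemma visit_avg_window N n h (del : R) : (0 < N)%N ->
    (1 - del) * #|` Phi S N|%:R <=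
      #|` [fset k in Phi S N | (n <= tau k <= n + h)%N]%fset|%:R :> R ->
    (forall m, (n <= m <= n + h)%N -> E (iter m (mps_T X) x)) ->
  1 - del <= visit_avg S E x N.
Proof.
move=> N0 hN hE.
have Phi0 : 0 < #|` Phi S N|%:R :> R by rewrite ltr0n cardfs_gt0 Phi_neq0.
rewrite /visit_avg mulrC ler_pdivlMr//; apply: (le_trans hN).
rewrite -sum1_size natr_sum big_fset /=.
rewrite big_mkcond; apply: ler_sum => k _; case: ifP => [/hE Ek|_].
  by rewrite indicE mem_set.
by rewrite indicE.
Qed.

End visits.

Lemma visit_avg_setC (R : realType) (S : averaging_scheme) (X : mps R)
    (E : set (borel (mps_space X))) (x : borel (mps_space X)) (N : nat) :
  (0 < N)%N -> visit_avg S (~` E) x N = 1 - visit_avg S E x N.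
Proof.
move=> N0.
have Phi0 : #|` Phi S N|%:R != 0 :> R by rewrite pnatr_eq0 cardfs_eq0 Phi_neq0.
apply/eqP; rewrite -subr_eq opprK /visit_avg -mulrDr -big_split /=.
rewrite (eq_bigr (fun=> 1)) => [|k _]; last first.
  by rewrite !indicE in_setC; case: (_ \in E); rewrite ?addr0 ?add0r.
have -> : \sum_(k <- Phi S N) (1 : R) = #|` Phi S N|%:R.
  by rewrite -sum1_size natr_sum.
by rewrite mulVf.
Qed.

(** * Strong sweeping out *)

Theorem theorem3p5 (R : realType) (S : averaging_scheme)
  (hEK : erdos_kac R S) : strong_sweeping_out R S.
Proof.
move=> X [T' [TK T'K mT']] ergT naT eps eps0.
(* The precision is [q.+1] below so that the [N] obtained is positive, which
   makes [Phi S N] nonempty. *)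
pose C q n h := exists2 N, (q <= N)%N &
  (1 - q.+1%:R^-1) * #|` Phi S N|%:R <=
  #|` [fset k in Phi S N | (n <= tau k <= n + h)%N]%fset|%:R :> R.
have C_windows q (eta : R) : 0 < eta -> exists n0 M h,
    [/\ (0 < M)%N, h.+1%:R * (2 / M%:R) <= eta &
    forall n, (n0 <= n < n0 + M)%N -> C q.+1 n h].
  by move=> eta0; exact: erdos_kac_windows.
have [|E [mE PE aeE]] := alternating_sweep (@mps_measurable _ X)
    (@mps_preserving _ X) mT' TK ergT (non_atomic_small_sets naT) C_windows (eps := eps / 2).
  by rewrite divr_gt0.
exists E; split => //.
  by apply: (le_lt_trans PE); rewrite lte_fin ltr_pdivrMr// ltr_pMr// ltr1n.
apply: filterS aeE => x hx; split.
  apply: limn_esup_eq1 => [N|q]; first exact: visit_avg_le1.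
  have [[r [n [h [qr [N rN hN] Em]]]] _] := hx q.
  have N0 : (0 < N)%N by exact: leq_trans rN.
  exists N; first by rewrite (leq_trans qr)// ltnW.
  apply: le_trans (visit_avg_window N0 hN Em).
  by rewrite lerB// lef_pV2 ?posrE ?ltr0n// ler_nat ltnS (leq_trans qr).
apply: limn_einf_eq0 => [N|q]; first exact: visit_avg_ge0.
have [_ [r [n [h [qr [N rN hN] Em]]]]] := hx q.
have N0 : (0 < N)%N by exact: leq_trans rN.
exists N; first by rewrite (leq_trans qr)// ltnW.
have := visit_avg_window (E := ~` E) N0 hN Em.
rewrite visit_avg_setC// lerD2l lerN2 => /le_trans; apply.
by rewrite lef_pV2 ?posrE ?ltr0n// ler_nat ltnS (leq_trans qr).
Qed.
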